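(* Let $(\mathbb{K},[\cdot,\cdot])$ be a Krein space with fundamental symmetry $J$, let $\{(W_i,v_i):i\in I\}$ be a $J$-fusion frame for $\mathbb{K}$, and let $T$ be a bounded surjective linear operator on $\mathbb{K}$ such that $\{(T(W_i),v_i):i\in I\}$ is also a $J$-fusion frame for $\mathbb{K}$. Then there exists an index set $I^0=I$ with a decomposition $I^0=I^0_+\cup I^0_-$ such that $$\mathbb{K}=\overline{\sum_{i\in I^0_+}T(W_i)}\oplus\overline{\sum_{i\in I^0_-}T(W_i)}$$ (direct sum), and $\overline{\sum_{i\in I^0_+}T(W_i)}$ and $\overline{\sum_{i\in I^0_-}T(W_i)}$ are maximal uniformly $J$-definite subspaces of $\mathbb{K}$ with opposite signs (one is maximal uniformly $J$-positive, the other maximal uniformly $J$-negative).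
   Context: $\langle f,g\rangle_J=[Jf,g]$ is the Hilbert space inner product of $\mathbb{K}$ and $\|\cdot\|_J$ its norm. For a closed subspace $W$, $\pi_W$ is the orthogonal projection onto $W$ with respect to $\langle\cdot,\cdot\rangle_J$. A subspace $W$ is $J$-non-negative if $[f,f]\ge 0$ for all $f\in W$; $J$-negative if $[f,f]<0$ for all nonzero $f\in W$; uniformly $J$-positive (resp. uniformly $J$-negative) if there is $\alpha>0$ with $[f,f]\ge\alpha\|f\|_J^2$ (resp. $-[f,f]\ge\alpha\|f\|_J^2$) for all $f\in W$. Maximality is with respect to inclusion. Families $\{(W_i,v_i):i\in I\}$ consist of closed subspaces $W_i$ of $\mathbb{K}$ with weights $v_i>0$, where each $W_i$ is either $J$-non-negative or $J$-negative. $I_+$ is the set of $i$ with $W_i$ $J$-non-negative, and $I_-$ the set of $i$ with $W_i\neq\{0\}$ and $W_i$ $J$-negative. The family is Bessel if $\sum_{i}v_i^2\|\pi_{W_i}f\|_J^2\le B\|f\|_J^2$ for some $B<\infty$ and all $f\in\mathbb{K}$. Let $(\sum_{i\in I}\oplus W_i)_{\ell_2}$ be the Hilbert space of families $\{f_i\}$, $f_i\in W_i$, with $\sum\|f_i\|_J^2<\infty$. The synthesis operator is $T_{W,v}\{f_i\}=\sum_{i\in I}v_if_i$. Let $P_\pm$ be the orthogonal projection of this space onto $(\sum_{i\in I_\pm}\oplus W_i)_{\ell_2}$, and ${T_{W,v}}_\pm=T_{W,v}P_\pm$. The Bessel family is a $J$-fusion frame for $\mathbb{K}$ if the range $R({T_{W,v}}_+)$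 is a maximal uniformly $J$-positive subspace and $R({T_{W,v}}_-)$ is a maximal uniformly $J$-negative subspace of $\mathbb{K}$. *)

(* Defs.v *)
(* Krein spaces are complex: the scalars are R[i] over R : realType. *)
From HB Require Import structures.
From mathcomp Require Import all_boot all_order all_algebra.
From mathcomp Require Import finmap complex.
From mathcomp Require Import all_classical all_reals all_analysis.
From mathcomp.analysis.showcase Require summability.

Set Implicit Arguments.
Unset Strict Implicit.
Unset Printing Implicit Defensive.
Import Order.TTheory GRing.Theory Num.Theory.
Import numFieldNormedType.Exports.
Local Open Scope classical_set_scope.
Local Open Scope complex_scope.
Local Open Scope ring_scope.

(* The norm of the underlying complete normed module is the J-norm: by
   [kJ_norm] it is induced by <f, g>_J = [J f, g], which is therefore a Hilbert
   space inner product on the carrier.  [kJ_invol] and [kJ_sym] say that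
   J = J^-1 = J^*; J is then P_+ - P_- for the fundamental decomposition
   ker (J - 1) [+] ker (J + 1). *)
Record kreinSpace (R : realType) := KreinSpace {
  kcarrier :> completeNormedModType R[i] ;
  kform : {hermitian kcarrier for false & Num.conj} ;
  kJ : {linear kcarrier -> kcarrier} ;
  kJ_invol : forall f, kJ (kJ f) = f ;
  kJ_sym : forall f g, kform (kJ f) g = kform f (kJ g) ;
  kJ_norm : forall f, `|f| ^+ 2 = kform (kJ f) f }.

Definition dotJ (R : realType) (K : kreinSpace R) (f g : K) : R[i] :=
  kform K (kJ K f) g.

Definition normJ (R : realType) (K : kreinSpace R) (f : K) : R :=
  Num.sqrt (complex.Re (dotJ f f)).

Lemma normJE (R : realType) (K : kreinSpace R) (f : K) :
  (normJ f)%:C = `|f|.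
Proof.
have rE : `|f| = (complex.Re `|f|)%:C by rewrite RRe_real // normr_real.
have r0 : 0 <= complex.Re `|f| by move: (normr_ge0 f); rewrite {1}rE lecR.
by rewrite /normJ /dotJ -kJ_norm rE -rmorphXn /= sqrtr_sqr ger0_norm.
Qed.

Definition subspace (R : realType) (K : kreinSpace R) (W : set K) : Prop :=
  submod_closed [in W].

(* [xget 0] returns 0 when no such g exists; for a closed subspace W there is
   exactly one. *)
Definition projJ (R : realType) (K : kreinSpace R) (W : set K) (f : K) : K :=
  xget 0 [set g | W g /\ forall h, W h -> dotJ (f - g) h = 0].

(* In the order of R[i], x <= y and x < y force x and y to have the same
   imaginary part; [f, f] is real. *)
Definition J_nonnegative (R : realType) (K : kreinSpace R) (W : set K) : Prop :=
  forall f, W f -> 0 <= kform K f f.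

Definition J_negative (R : realType) (K : kreinSpace R) (W : set K) : Prop :=
  forall f, W f -> f != 0 -> kform K f f < 0.

Definition uniformly_J_positive (R : realType) (K : kreinSpace R) (W : set K) :
    Prop :=
  exists2 alpha : R, 0 < alpha &
    forall f, W f -> (alpha * normJ f ^+ 2)%:C <= kform K f f.

Definition uniformly_J_negative (R : realType) (K : kreinSpace R) (W : set K) :
    Prop :=
  exists2 alpha : R, 0 < alpha &
    forall f, W f -> (alpha * normJ f ^+ 2)%:C <= - kform K f f.

Definition maximal_subspace (R : realType) (K : kreinSpace R)
    (P : set K -> Prop) (M : set K) : Prop :=
  [/\ subspace M, P M &
      forall N : set K, subspace N -> P N -> M `<=` N -> N = M].

Definition J_family (R : realType) (K : kreinSpace R) (I : choiceType)
    (W : I -> set K) (v : I -> R) : Prop :=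
  forall i, [/\ subspace (W i), closed (W i), 0 < v i &
                J_nonnegative (W i) \/ J_negative (W i)].

Definition index_pos (R : realType) (K : kreinSpace R) (I : choiceType)
    (W : I -> set K) : set I :=
  [set i | J_nonnegative (W i)].

Definition index_neg (R : realType) (K : kreinSpace R) (I : choiceType)
    (W : I -> set K) : set I :=
  [set i | W i <> [set 0] /\ J_negative (W i)].

Definition bessel (R : realType) (K : kreinSpace R) (I : choiceType)
    (W : I -> set K) (v : I -> R) : Prop :=
  exists B : R, forall f : K,
    (\esum_(i in [set: I]) (v i ^+ 2 * normJ (projJ (W i) f) ^+ 2)%:E
       <= (B * normJ f ^+ 2)%:E)%E.

Definition ell2_sum (R : realType) (K : kreinSpace R) (I : choiceType)
    (W : I -> set K) : set (I -> K) :=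
  [set x | (forall i, W i (x i)) /\
           (\esum_(i in [set: I]) (normJ (x i) ^+ 2)%:E < +oo)%E].

(* [summability.sum] is the unordered sum: the limit in norm of the finite
   partial sums along the directed set {fset I}. *)
Definition synthesis (R : realType) (K : kreinSpace R) (I : choiceType)
    (v : I -> R) (x : I -> K) : K :=
  summability.sum (fun i => (v i)%:C *: x i).

(* The l2-sum over a subset A of I, seen inside the l2-sum over I. *)
Definition ell2_sum_on (R : realType) (K : kreinSpace R) (I : choiceType)
    (W : I -> set K) (A : set I) : set (I -> K) :=
  [set x | ell2_sum W x /\ forall i, ~ A i -> x i = 0].

Definition ell2_dot (R : realType) (K : kreinSpace R) (I : choiceType)
    (x y : I -> K) : R[i] :=
  summability.sum (fun i => dotJ (x i) (y i) : R[i]^o).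

(* The orthogonal projection onto [ell2_sum_on W A] cancels the coordinates
   outside A; see [ell2_proj_orthogonal]. *)
Definition ell2_proj (R : realType) (K : kreinSpace R) (I : choiceType)
    (A : set I) (x : I -> K) : I -> K :=
  patch (cst 0) A x.

Lemma sum_eq0 (F : numFieldType) (V : normedModType F) (I : choiceType)
    (x : I -> V) :
  (forall i, x i = 0) -> summability.sum x = 0.
Proof.
move=> x0; rewrite /summability.sum.
have -> : summability.partial_sum x = cst 0.
  by apply/funext => S; rewrite /summability.partial_sum big1.
have tot := @summability.totally_filter I.
by apply: cvg_lim; [exact: norm_hausdorff | exact: cvg_cst].
Qed.

Lemma ell2_proj_orthogonal (R : realType) (K : kreinSpace R) (I : choiceType)
    (W : I -> set K) (A : set I) (x : I -> K) :
  (forall i, subspace (W i)) -> ell2_sum W x ->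
  ell2_sum_on W A (ell2_proj A x) /\
  forall y, ell2_sum_on W A y -> ell2_dot (x - ell2_proj A x) y = 0.
Proof.
move=> subW [xW x2]; split=> [|y [_ yA]].
  split; last by move=> i nAi; rewrite /ell2_proj patchN ?notin_setE.
  split=> [i|].
    rewrite /ell2_proj /patch; case: ifP => // _.
    by have [W0 _] := subW i; apply/set_mem; exact: W0.
  apply: le_lt_trans x2; apply: le_esum => i _.
  rewrite lee_fin /ell2_proj /patch; case: ifP => // _.
  by rewrite /normJ /dotJ !linear0 sqrtr0 expr0n sqr_ge0.
apply: (@sum_eq0 R[i] R[i]^o) => i; rewrite /dotJ; case: (pselect (A i)) => Ai; last first.
  by rewrite (yA _ Ai) linear0.
by rewrite !fctE /ell2_proj patchT ?inE// subrr linear0 linear0l.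
Qed.

Definition synthesis_range (R : realType) (K : kreinSpace R) (I : choiceType)
    (W : I -> set K) (v : I -> R) (A : set I) : set K :=
  (synthesis v \o ell2_proj A) @` ell2_sum W.

Definition J_fusion_frame (R : realType) (K : kreinSpace R) (I : choiceType)
    (W : I -> set K) (v : I -> R) : Prop :=
  [/\ J_family W v, bessel W v,
      maximal_subspace (@uniformly_J_positive R K)
        (synthesis_range W v (index_pos W)) &
      maximal_subspace (@uniformly_J_negative R K)
        (synthesis_range W v (index_neg W))].

Definition algebraic_sum (R : realType) (K : kreinSpace R) (I : choiceType)
    (A : set I) (W : I -> set K) : set K :=
  [set f | exists (F : {fset I}) (x : I -> K),
     (forall i, i \in F -> A i /\ W i (x i)) /\ f = \sum_(i <- F) x i].

Definition direct_sum (R : realType) (K : kreinSpace R) (M N : set K) : Prop :=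
  M `&` N = [set 0] /\ forall f : K, exists2 m, M m & exists2 n, N n & f = m + n.

(* Main.v *)
(* Take I_+ and I_- to be the index sets of the second frame; that T(W) is a
   J-fusion frame already gives the result.

   A maximal uniformly J-definite subspace is closed, because its closure is
   again uniformly J-definite. The algebraic sum over I_+ lies in the range of
   the synthesis operator (finitely supported families) and is dense in it
   (partial sums), so its closure is that range; likewise for I_-.

   It remains to see that a maximal uniformly J-positive M and a maximal
   uniformly J-negative N span the space. The sum M + N is closed because
   Re [m + n, m - n] = [m, m] - [n, n] bounds m and n by m + n. A vector h that
   is J-orthogonal to M with [h, h] >= 0 vanishes, since otherwise h + t J h
   could be adjoined to M for a suitable t > 0; symmetrically for N. Hence
   nothing but 0 is J-orthogonal to M + N, and M + N is everything by the
   projection theorem. *)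
Require Import Defs.
From mathcomp Require Import all_boot all_order all_algebra.
From mathcomp Require Import finmap complex ring lra.
From mathcomp Require Import all_classical all_reals all_analysis.
Import Order.TTheory GRing.Theory Num.Theory.
Import numFieldNormedType.Exports.
(* all_analysis has another [subspace] (the subspace topology). *)
Import Defs.
Local Open Scope classical_set_scope.
Local Open Scope ring_scope.

(** * The real part of the Krein form *)
Section ReForm.
Context {R : realType} {K : kreinSpace R}.
Implicit Types (f g h m n : K) (a e : R) (c : R[i]) (M N S : set K).
Local Open Scope complex_scope.

(** The real part is a symmetric real bilinear form with values in an ordered field, so expansions
    and estimates become real arithmetic. On the diagonal it loses nothing, by [form_real]. *)
Definition reform f g : R := complex.Re (kform K f g).

Lemma Re_conj (z : R[i]) : complex.Re (Num.conj z) = complex.Re z.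
Proof. by case: z. Qed.

Lemma reformC f g : reform f g = reform g f.
Proof. by rewrite /reform hermC /= expr0 mul1r Re_conj. Qed.

Lemma reformDl f g h : reform (f + g) h = reform f h + reform g h.
Proof. by rewrite /reform linearDl raddfD. Qed.

Lemma reformNl f h : reform (- f) h = - reform f h.
Proof. by rewrite /reform linearNl raddfN. Qed.

Lemma reformZl a f h : reform (a%:C *: f) h = a * reform f h.
Proof.
rewrite /reform linearZl_LR /=.
by case: (kform K f h) => x y /=; rewrite mul0r subr0.
Qed.

Lemma reformDr f g h : reform f (g + h) = reform f g + reform f h.
Proof. by rewrite !(reformC f) reformDl. Qed.

Lemma reformNr f h : reform f (- h) = - reform f h.
Proof. by rewrite !(reformC f) reformNl. Qed.

Lemma reformZr a f h : reform f (a%:C *: h) = a * reform f h.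
Proof. by rewrite !(reformC f) reformZl. Qed.

Definition reformE := (reformDl, reformDr, reformNl, reformNr, reformZl, reformZr).

Lemma reformZ_conj c f g : reform (c *: f) g = reform f (Num.conj c *: g).
Proof. by rewrite /reform linearZl_LR linearZr_LR /= conjCK. Qed.

Lemma form_real f : kform K f f = (reform f f)%:C.
Proof.
rewrite /reform; have := hermC (kform K) f f.
case: (kform K f f) => x y /=; rewrite expr0 mul1r => -[/eqP].
by rewrite -addr_eq0 -mulr2n mulrn_eq0 /= => /eqP ->.
Qed.

Lemma reformJ f g : reform (kJ K f) g = reform f (kJ K g).
Proof. by rewrite /reform kJ_sym. Qed.

Lemma reformJJ f g : reform (kJ K f) (kJ K g) = reform f g.
Proof. by rewrite reformJ kJ_invol. Qed.

Lemma normJ_sqr f : normJ f ^+ 2 = reform (kJ K f) f.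
Proof.
by rewrite -[RHS]/(complex.Re (kform K _ _)) -kJ_norm -normJE -rmorphXn.
Qed.

Lemma normJ_ge0 f : 0 <= normJ f.
Proof. exact: sqrtr_ge0. Qed.

Lemma normJ_kJ f : normJ (kJ K f) = normJ f.
Proof.
apply/eqP; rewrite -(eqrXn2 (n := 2)) ?normJ_ge0//.
by rewrite !normJ_sqr kJ_invol reformJ.
Qed.

Lemma ler_normJD f g : normJ (f + g) <= normJ f + normJ g.
Proof. by rewrite -lecR rmorphD /= !normJE ler_normD. Qed.

Lemma normJN f : normJ (- f) = normJ f.
Proof. by apply/complexI; rewrite !normJE normrN. Qed.

Lemma normJB f g : normJ (f - g) = normJ (g - f).
Proof. by rewrite -normJN opprB. Qed.

Lemma normJ0 : normJ (0 : K) = 0.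
Proof. by apply/complexI; rewrite normJE normr0. Qed.

Lemma normJ_eq0 f : (normJ f == 0) = (f == 0).
Proof. by rewrite -(inj_eq (@complexI R)) normJE normr_eq0. Qed.

(** The Cauchy-Schwarz inequality, obtained by squaring the triangle inequality of the given
    norm. *)
Lemma reformJ_le f g : reform (kJ K f) g <= normJ f * normJ g.
Proof.
have : normJ (f + g) ^+ 2 <= (normJ f + normJ g) ^+ 2.
  by rewrite lerXn2r ?nnegrE ?addr_ge0 ?normJ_ge0 ?ler_normJD.
rewrite sqrrD !normJ_sqr linearD !reformE (reformC (kJ K g) f) -(reformJ f g).
by lra.
Qed.

Lemma reform_le f g : `|reform f g| <= normJ f * normJ g.
Proof.
have := reformJ_le (kJ K f) g; have := reformJ_le (kJ K f) (- g).
by rewrite kJ_invol normJ_kJ normJN reformE => ? ?; rewrite ler_norml; lra.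
Qed.

(** Balls of the carrier have radii in [R[i]]; a positive radius is real there, so real radii
    suffice. *)
Lemma closure_normJP S f :
  closure S f <-> forall e, 0 < e -> exists2 g, S g & normJ (f - g) < e.
Proof.
split=> [Sf e e0|Sf B /nbhs_ballP[e /= e0 eB]].
  have /Sf[g [Sg]] : nbhs f (ball f e%:C) by apply: nbhsx_ballx; rewrite ltcR.
  by rewrite -ball_normE /= -normJE ltcR; exists g.
have eE : e = (complex.Re e)%:C by rewrite RRe_real ?gtr0_real.
have [|g Sg fg] := Sf (complex.Re e); first by rewrite -ltcR -eE.
by exists g; split => //; apply: eB; rewrite -ball_normE /= -normJE eE ltcR.
Qed.

Lemma normJ_complete (u : nat -> K) :
  (forall e, 0 < e -> exists k, forall i j, (k <= i)%N -> (k <= j)%N ->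
     normJ (u i - u j) < e) ->
  exists l, forall e, 0 < e -> exists k, forall i, (k <= i)%N ->
    normJ (l - u i) < e.
Proof.
move=> uC; have : cauchy (u @ \oo).
  apply/cauchy_exP => e e0.
  have eE : e = (complex.Re e)%:C by rewrite RRe_real ?gtr0_real.
  have [|k uk] := uC (complex.Re e); first by rewrite -ltcR -eE.
  exists (u k); exists k => // i /= ki.
  by rewrite -ball_normE /= -normJE eE ltcR uk.
move=> /cauchy_cvgP/cvg_ex[l ul]; exists l => e e0.
have [|k _ uk] := proj1 (cvgrPdist_lt _ _) ul e%:C; first by rewrite ltcR.
by exists k => i ki; rewrite -ltcR normJE; exact: uk.
Qed.

Lemma subspaceD S f g : subspace S -> S f -> S g -> S (f + g).
Proof.
move=> [_ SZ] Sf Sg; have := SZ 1 f g; rewrite scale1r !in_setE; exact.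
Qed.

Lemma subspace0 S : subspace S -> S 0.
Proof. by move=> [S0 _]; rewrite in_setE in S0. Qed.

Lemma subspaceZ S c f : subspace S -> S f -> S (c *: f).
Proof.
move=> sS Sf; have [_ SZ] := sS.
have := SZ c f 0; rewrite addr0 !in_setE; apply=> //; exact: subspace0.
Qed.

Lemma subspaceB S f g : subspace S -> S f -> S g -> S (f - g).
Proof.
by move=> sS Sf Sg; apply: subspaceD => //; rewrite -scaleN1r; apply: subspaceZ.
Qed.

Lemma subspaceP S : S 0 -> (forall c f g, S f -> S g -> S (c *: f + g)) ->
  subspace S.
Proof.
by move=> S0 SZ; split=> [|c f g]; rewrite !in_setE //; exact: SZ.
Qed.
End ReForm.

(** * Orthogonal projection *)
Section Hilbert.
Context {R : realType} {K : kreinSpace R}.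
Implicit Types (f g h m n : K) (a e : R) (c : R[i]) (M N S : set K).
Local Open Scope complex_scope.

Lemma invS_lt e : 0 < e -> exists k, forall i, (k <= i)%N -> i.+1%:R^-1 < e.
Proof. by move=> e0; have [k _ kP] := near_infty_natSinv_lt (PosNum e0); exists k. Qed.

Lemma closed_normJ_lim S l (u : nat -> K) : closed S -> (forall i, S (u i)) ->
  (forall e, 0 < e -> exists k, forall i, (k <= i)%N -> normJ (l - u i) < e) ->
  S l.
Proof.
move=> cS Su ul; apply: cS; apply/closure_normJP => e /ul[k uk].
by exists (u k) => //; apply: uk.
Qed.

Lemma min_dist_orthogonal S f p : subspace S -> S p ->
  (forall s, S s -> normJ (f - p) <= normJ (f - s)) ->
  forall s, S s -> reform (kJ K (f - p)) s = 0.
Proof.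
move=> sS Sp pmin s Ss.
set x := reform _ _; set y := normJ s ^+ 2.
have y0 : 0 <= y by rewrite sqr_ge0.
have ineq t : 0 <= t ^+ 2 * y - 2 * t * x.
  have St : S (p + t%:C *: s) by apply: subspaceD => //; exact: subspaceZ.
  have := pmin _ St; rewrite -ler_sqr ?nnegrE ?normJ_ge0//.
  rewrite opprD addrA; move: (f - p) @x => g x.
  rewrite !normJ_sqr !(linearD, linearN) !reformE.
  have -> : kJ K (t%:C *: s) = t%:C *: kJ K s by rewrite linearZ.
  rewrite !reformE (reformJ s) (reformC s) -/x -!normJ_sqr -/y; lra.
(* The value [1 + y] in place of the minimizing [y] keeps the denominator positive when [s = 0]. *)
have := ineq (x / (1 + y)).
have -> : (x / (1 + y)) ^+ 2 * y - 2 * (x / (1 + y)) * x =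
  - (x ^+ 2 * ((2 + y) / (1 + y) ^+ 2)) by field; lra.
rewrite oppr_ge0 pmulr_lle0 ?divr_gt0 ?exprn_gt0 ?ltr_wpDr//.
by move=> h; apply/eqP; rewrite -sqrf_eq0 eq_le h sqr_ge0.
Qed.

(** The parallelogram law for [f - x] and [f - y]. *)
Lemma normJ_midpoint f x y :
  normJ (x - y) ^+ 2 + 4 * normJ (f - (1 / 2 : R)%:C *: (x + y)) ^+ 2 =
  2 * normJ (f - x) ^+ 2 + 2 * normJ (f - y) ^+ 2.
Proof.
rewrite !normJ_sqr !(linearD, linearN) /= !linearZ /= !reformE.
rewrite (reformJ x f) (reformC x) (reformJ y f) (reformC y).
rewrite (reformJ y x) (reformC y (kJ K x)); by field.
Qed.

(** A sequence in S minimizing the distance to f is Cauchy by the parallelogram law, since midpoints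
    stay in S; its limit is a nearest point. *)
Lemma projection_exists S f : subspace S -> closed S ->
  exists2 p, S p & forall s, S s -> reform (kJ K (f - p)) s = 0.
Proof.
move=> sS cS; pose D := [set normJ (f - s) | s in S].
have D0 : D !=set0 by exists (normJ (f - 0)); exists 0 => //; exact: subspace0.
have Dlb : has_lbound D by exists 0 => _ [s _ <-]; exact: normJ_ge0.
pose d := inf D.
have dS s : S s -> d <= normJ (f - s) by move=> Ss; apply: ge_inf => //; exists s.
have d0 : 0 <= d by apply: lb_le_inf => // _ [s _ <-]; exact: normJ_ge0.
have /choice[u uP] : forall i : nat, exists s, S s /\ normJ (f - s) < d + i.+1%:R^-1.
  move=> i; have [] := @inf_adherent _ D i.+1%:R^-1 => [//|//|_ [s Ss <-] ?].
  by exists s.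
have Su i : S (u i) by case: (uP i).
have fu i : normJ (f - u i) < d + i.+1%:R^-1 by case: (uP i).
have [|l ul] := @normJ_complete _ _ u.
  (* When both distances are below [d + t], the squared gap is at most
     [4 * (d + t) ^+ 2 - 4 * d ^+ 2], which [t <= 1] bounds by [t * (8 * d + 4)]. *)
  move=> e e0; pose t := Num.min 1 (e ^+ 2 / (8 * d + 5)).
  have t0 : 0 < t by rewrite lt_min ltr01 divr_gt0 ?exprn_gt0//; lra.
  have [k kt] := invS_lt _ t0; exists k => i j /kt ti /kt tj.
  have /(dS _) dm : S ((1 / 2 : R)%:C *: (u i + u j)).
    by apply: subspaceZ => //; apply: subspaceD.
  have di := le_lt_trans (dS _ (Su i)) (fu i).
  rewrite -ltr_sqr ?nnegrE ?normJ_ge0 ?ltW//.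
  have := normJ_midpoint f (u i) (u j).
  have sq a b : 0 <= a -> a <= b -> a ^+ 2 <= b ^+ 2.
    by move=> a0 ab; rewrite ler_sqr ?nnegrE// (le_trans a0).
  have lt_t l : l.+1%:R^-1 < t -> normJ (f - u l) ^+ 2 <= (d + t) ^+ 2.
    by move=> lt; apply: sq (normJ_ge0 _) (le_trans (ltW (fu l)) _); rewrite lerD2l ltW.
  move: (lt_t _ ti) (lt_t _ tj) (sq _ _ d0 dm).
  have t1 : t <= 1 by rewrite ge_min lexx.
  have : t * (8 * d + 5) <= e ^+ 2.
    by rewrite -ler_pdivlMr ?ge_min ?lexx ?orbT//; lra.
  nra.
exists l; first exact: closed_normJ_lim ul.
apply: min_dist_orthogonal => //; first exact: closed_normJ_lim ul.
move=> s /dS; apply: le_trans; apply/ler_addgt0Pr => e e0.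
have e2 : 0 < e / 2 by lra.
have [k1 k1P] := ul _ e2; have [k2 k2P] := invS_lt _ e2.
pose k := maxn k1 k2.
have := k1P k (leq_maxl _ _); have := k2P k (leq_maxr _ _); have := fu k.
have := ler_normJD (f - u k) (u k - l); rewrite subrKA (normJB l).
by move: k.+1%:R^-1 => x; lra.
Qed.
End Hilbert.

(** * Uniformly definite subspaces *)
Section Definite.
Context {R : realType} {K : kreinSpace R}.
Implicit Types (f g h m n : K) (a e w : R) (c : R[i]) (M N S : set K).
Local Open Scope complex_scope.

Lemma normJZ c f : normJ (c *: f) = complex.Re `|c| * normJ f.
Proof.
by apply/complexI; rewrite rmorphM /= !normJE normrZ; congr (_ * _).
Qed.

Lemma closure_subspace S : subspace S -> subspace (closure S).
Proof.
move=> sS; apply: subspaceP => [|c f g].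
  by apply: subset_closure; exact: (subspace0 _ sS).
move=> /(proj1 (closure_normJP _ _)) Sf /(proj1 (closure_normJP _ _)) Sg.
apply/closure_normJP => e e0.
pose x := complex.Re `|c|.
have x0 : 0 <= x by have := normr_ge0 c; rewrite lecE => /andP[].
(* The summand 1 keeps the denominator positive when [c = 0]. *)
have [|f' Sf' ff'] := Sf (e / (2 * (1 + x))); first by rewrite divr_gt0//; lra.
have [|g' Sg' gg'] := Sg (e / 2); first by lra.
exists (c *: f' + g'); first by apply: subspaceD => //; exact: subspaceZ.
have -> : c *: f + g - (c *: f' + g') = c *: (f - f') + (g - g').
  by rewrite scalerBr opprD addrACA.
apply: le_lt_trans (ler_normJD _ _) _; rewrite normJZ -/x.
have : normJ (f - f') * (2 * (1 + x)) < e by rewrite -ltr_pdivlMr//; lra.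
have := normJ_ge0 (f - f'); nra.
Qed.

(* For [w = 1] and [w = -1] this is uniform J-positivity and uniform
   J-negativity. *)
Definition uniformly_definite w M : Prop :=
  exists2 a, 0 < a & forall f, M f -> a * normJ f ^+ 2 <= w * reform f f.

Lemma uniformly_J_positiveE : @uniformly_J_positive R K = uniformly_definite 1.
Proof.
apply/funext => M; apply/propext; split=> -[a a0 aM]; exists a => // f /aM;
  by rewrite form_real lecR mul1r.
Qed.

Lemma uniformly_J_negativeE : @uniformly_J_negative R K = uniformly_definite (- 1).
Proof.
apply/funext => M; apply/propext; split=> -[a a0 aM]; exists a => // f /aM;
  by rewrite form_real -rmorphN lecR mulN1r.
Qed.

(** Both sides of the defining inequality are continuous, so the same constant works on the
    closure. *)
Lemma closure_uniformly_definite w M : w ^+ 2 = 1 ->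
  uniformly_definite w M -> uniformly_definite w (closure M).
Proof.
move=> w1 [a a0 aM]; exists a => // f /(proj1 (closure_normJP _ _)) Mf.
apply/ler_addgt0Pr => e e0.
have nf := normJ_ge0 f.
(* For g within t of f, each side changes by a multiple of [t * (2 * normJ f + t)], with factors a
   and 1; this t makes the total error at most e. *)
pose t := Num.min 1 (e / ((a + 1) * (2 * normJ f + 1))).
have t0 : 0 < t by rewrite lt_min ltr01 divr_gt0 // mulr_gt0; lra.
have t1 : t <= 1 by rewrite ge_min lexx.
have te : t * ((a + 1) * (2 * normJ f + 1)) <= e.
  by rewrite -ler_pdivlMr ?ge_min ?lexx ?orbT// mulr_gt0; lra.
have [g Mg fg] := Mf t t0.
have ng := normJ_ge0 g.
have fDg : normJ (f + g) <= 2 * normJ f + t.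
  have := ler_normJD (f + f) (g - f); have := ler_normJD f f.
  by rewrite addrACA subrr addr0 (normJB g) => ? ?; lra.
have fLg : normJ f <= normJ g + t.
  by have := ler_normJD (f - g) g; rewrite subrK; lra.
have gLf : normJ g <= normJ f + t.
  by have := ler_normJD (g - f) f; rewrite subrK normJB; lra.
have wq : w * reform g g - w * reform f f <= t * (2 * normJ f + t).
  have -> : w * reform g g - w * reform f f = - (w * reform (f - g) (f + g)).
    by rewrite !reformE (reformC g f); ring.
  apply: le_trans (ler_norm _) _; rewrite normrN normrM.
  have -> : `|w| = 1 by apply/eqP; rewrite -sqr_norm_eq1 w1.
  rewrite mul1r; apply: le_trans (reform_le _ _) _.
  by apply: ler_pM; rewrite ?normJ_ge0 // ltW.
have nn : normJ f ^+ 2 - normJ g ^+ 2 <= t * (2 * normJ f + t).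
  rewrite subr_sqr; apply: (@le_trans _ _ (t * (normJ f + normJ g))).
    by rewrite ler_wpM2r ?addr_ge0//; lra.
  by rewrite ler_pM2l//; lra.
have : a * (normJ f ^+ 2 - normJ g ^+ 2) <= a * (t * (2 * normJ f + t)).
  by rewrite ler_pM2l.
have : (a + 1) * (t * (2 * normJ f + t)) <= (a + 1) * (t * (2 * normJ f + 1)).
  by rewrite ler_pM2l ?ler_pM2l//; lra.
have := aM g Mg; lra.
Qed.

Lemma maximal_closed w M : w ^+ 2 = 1 ->
  maximal_subspace (uniformly_definite w) M -> closed M.
Proof.
move=> w1 [sM uM Mmax]; rewrite -[M in closed M](Mmax (closure M)).
- exact: closed_closure.
- exact: closure_subspace.
- exact: closure_uniformly_definite.
- exact: subset_closure.
Qed.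

(* If [h != 0] were J-orthogonal to M with [w * [h, h] >= 0], then for
   [t = w * a / 2], with [a] the constant of uniform definiteness of M, the
   vector [h + t *: J h] could be adjoined to M. *)
Lemma maximal_orthogonal w M h : w ^+ 2 = 1 ->
  maximal_subspace (uniformly_definite w) M ->
  (forall m, M m -> reform h m = 0) -> 0 <= w * reform h h -> h = 0.
Proof.
move=> w1 [sM [a a0 aM] Mmax] hM hh.
pose t := w * a / 2.
have w_abs : `|w| = 1 by apply/eqP; rewrite -sqr_norm_eq1 w1.
pose H g := g + t%:C *: kJ K g.
have HZ c : c *: H h = H (c *: h).
  by rewrite /H scalerDr (linearZ_LR (kJ K)) !scalerA (mulrC c).
pose N := [set f | exists c, exists2 m, M m & f = m + c *: H h].
have sN : subspace N.
  apply: subspaceP => [|d _ _ [c [m Mm ->]] [c' [m' Mm' ->]]].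
    by exists 0, 0; [exact: (subspace0 _ sM)|rewrite scale0r addr0].
  exists (d * c + c'), (d *: m + m').
    by apply: subspaceD => //; exact: subspaceZ.
  by rewrite scalerDr scalerDl scalerA addrACA.
have uN : uniformly_definite w N.
  (* The quotient of the lower bound [a / 2 * (normJ m ^+ 2 + normJ k ^+ 2)] for the form by the
     upper bound [(1 + a) ^+ 2 * (2 * (normJ m ^+ 2 + normJ k ^+ 2))] for the squared norm. *)
  exists (a / (4 * (1 + a) ^+ 2)); first by rewrite divr_gt0// mulr_gt0// exprn_gt0; lra.
  move=> _ [c [m Mm ->]]; rewrite HZ.
  (* Orthogonality to M and the sign condition pass from h to every multiple [k = c *: h], so the
     scalar can be forgotten. *)
  have {hM} kM : reform (c *: h) m = 0.
    by rewrite reformZ_conj hM//; exact: subspaceZ.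
  have {hh} kk : 0 <= w * reform (c *: h) (c *: h).
    have cc : Num.conj c * c = ((complex.Re `|c|) ^+ 2)%:C.
      have cE : `|c| = (complex.Re `|c|)%:C by rewrite RRe_real ?normr_real.
      by rewrite -normCKC {1}cE rmorphXn.
    by rewrite reformZ_conj scalerA cc reformZr mulrCA mulr_ge0 ?sqr_ge0.
  move: (c *: h) kM kk => k kM kk; rewrite /H.
  have wt : w * t = a / 2 by rewrite /t -mulrA mulrA -expr2 w1 mul1r.
  have -> : w * reform (m + (k + t%:C *: kJ K k)) (m + (k + t%:C *: kJ K k)) =
      w * reform m m + 2 * (w * t) * reform (kJ K k) m +
      (1 + t ^+ 2) * (w * reform k k) + 2 * (w * t) * normJ k ^+ 2.
    rewrite normJ_sqr !reformE reformJJ -(reformJ k k) !(reformC m) kM; ring.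
  have nt : normJ (m + (k + t%:C *: kJ K k)) <= (1 + a) * (normJ m + normJ k).
    apply: le_trans (ler_normJD _ _) _; have := ler_normJD k (t%:C *: kJ K k).
    have : complex.Re `|t%:C| = a / 2.
      rewrite normc_def /= expr0n addr0 sqrtr_sqr /t !normrM w_abs mul1r.
      by rewrite !gtr0_norm.
    rewrite normJZ normJ_kJ => ->.
    have := normJ_ge0 m; have := normJ_ge0 k; nra.
  have {nt} : normJ (m + (k + t%:C *: kJ K k)) ^+ 2 <=
      (1 + a) ^+ 2 * (2 * (normJ m ^+ 2 + normJ k ^+ 2)).
    apply: (@le_trans _ _ (((1 + a) * (normJ m + normJ k)) ^+ 2)).
      by rewrite ler_sqr ?nnegrE ?mulr_ge0 ?addr_ge0 ?normJ_ge0 //; lra.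
    rewrite exprMn ler_pM2l ?exprn_gt0//; last by lra.
    by have := sqr_ge0 (normJ m - normJ k); lra.
  move=> nt; rewrite wt mulrAC ler_pdivrMr; last by rewrite mulr_gt0// exprn_gt0; lra.
  have Jkm : - (normJ k * normJ m) <= reform (kJ K k) m.
    have := reform_le (kJ K k) m; rewrite normJ_kJ ler_norml; lra.
  have := aM m Mm => qm.
  have t2 : 0 <= t ^+ 2 * (w * reform k k) by rewrite mulr_ge0 ?sqr_ge0.
  (* The right-hand side is at least a times [normJ m ^+ 2 - normJ m * normJ k + normJ k ^+ 2]; the
     square of [normJ m - normJ k] absorbs the product. *)
  have : a / 2 * (normJ m ^+ 2 + normJ k ^+ 2) <= w * reform m m +
      2 * (a / 2) * reform (kJ K k) m + (1 + t ^+ 2) * (w * reform k k) +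
      2 * (a / 2) * normJ k ^+ 2.
    have : a * - (normJ k * normJ m) <= a * reform (kJ K k) m.
      by rewrite ler_pM2l.
    have : 0 <= a * (normJ m - normJ k) ^+ 2 by rewrite mulr_ge0 ?sqr_ge0// ltW.
    lra.
  rewrite -(ler_pM2r (_ : 0 < 4 * (1 + a) ^+ 2)); last first.
    by rewrite mulr_gt0// exprn_gt0; lra.
  move/(le_trans _); apply; have := ler_wpM2l (ltW a0) nt; lra.
have NM : N = M.
  by apply: Mmax => // m Mm; exists 0, m; rewrite // scale0r addr0.
have Mh : M (H h).
  by rewrite -NM; exists 1, 0; [exact: (subspace0 _ sM)|rewrite scale1r add0r].
(* Now h is J-orthogonal to [H h] itself. Multiplied by w, this is a sum of two non-negative terms
   equal to 0, one of them [a / 2 * normJ h ^+ 2]. *)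
have := hM _ Mh; rewrite /H !reformE -reformJ -normJ_sqr => h0.
have : w * reform h h + a / 2 * normJ h ^+ 2 = 0.
  have wt : w * t = a / 2 by rewrite /t -mulrA mulrA -expr2 w1 mul1r.
  by rewrite -wt -mulrA -mulrDr h0 mulr0.
move=> e0; have /eqP : normJ h ^+ 2 = 0.
  have := sqr_ge0 (normJ h); nra.
by rewrite sqrf_eq0 normJ_eq0 => /eqP.
Qed.

End Definite.

(** * Decomposition by maximal definite subspaces *)
Section Decomposition.
Context {R : realType} {K : kreinSpace R}.
Implicit Types (f g h m n : K) (a e w : R) (c : R[i]) (M N S : set K).
Local Open Scope complex_scope.

(* [w * Re [m + n, m - n] = w * [m, m] - w * [n, n]], the mixed terms being
   purely imaginary. *)
Lemma definite_sum_bound w M N : w ^+ 2 = 1 ->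
  uniformly_definite w M -> uniformly_definite (- w) N ->
  exists2 C, 0 < C & forall m n, M m -> N n ->
    normJ m <= C * normJ (m + n) /\ normJ n <= C * normJ (m + n).
Proof.
move=> w1 [a a0 aM] [b b0 bN]; pose d := Num.min a b.
have d0 : 0 < d by rewrite lt_min a0.
have da : d <= a by rewrite ge_min lexx.
have db : d <= b by rewrite ge_min lexx orbT.
have w_abs : `|w| = 1 by apply/eqP; rewrite -sqr_norm_eq1 w1.
exists (2 / d); first by rewrite divr_gt0.
move=> m n Mm Nn.
have m0 := normJ_ge0 m; have n0 := normJ_ge0 n.
have low : a * normJ m ^+ 2 + b * normJ n ^+ 2 <= w * reform (m + n) (m - n).
  by have := aM m Mm; have := bN n Nn; rewrite !reformE (reformC n m); lra.
have up : w * reform (m + n) (m - n) <= normJ (m + n) * (normJ m + normJ n).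
  apply: le_trans (ler_norm _) _; rewrite normrM w_abs mul1r.
  apply: le_trans (reform_le _ _) _; rewrite ler_wpM2l ?normJ_ge0//.
  by have := ler_normJD m (- n); rewrite normJN.
(* With s the sum of the two norms, [low] and [up] give [d * s ^+ 2 / 2 <= normJ (m + n) * s]; s is
   cancelled when positive. *)
suff : d * (normJ m + normJ n) <= 2 * normJ (m + n).
  rewrite mulrAC !ler_pdivlMr// !(mulrC _ d) => le2.
  by split; apply: le_trans le2; rewrite ler_pM2l//; lra.
have := normJ_ge0 (m + n).
have [s0|s0] := leP (normJ m + normJ n) 0; first by nra.
move=> _; rewrite -(ler_pM2r s0).
have am : d * normJ m ^+ 2 <= a * normJ m ^+ 2 by rewrite ler_wpM2r ?sqr_ge0.
have bn : d * normJ n ^+ 2 <= b * normJ n ^+ 2 by rewrite ler_wpM2r ?sqr_ge0.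
have : 0 <= d * (normJ m - normJ n) ^+ 2 by rewrite mulr_ge0 ?sqr_ge0// ltW.
by lra.
Qed.

(** By [definite_sum_bound] applied to differences, a convergent sequence of sums has Cauchy
    components, whose limits stay in M and N. *)
Lemma definite_sum_closed w M N : w ^+ 2 = 1 ->
  subspace M -> subspace N -> closed M -> closed N ->
  uniformly_definite w M -> uniformly_definite (- w) N ->
  closed [set f | exists2 m, M m & exists2 n, N n & f = m + n].
Proof.
move=> w1 sM sN cM cN uM uN.
have [C C0 CP] := definite_sum_bound _ _ _ w1 uM uN.
set S := [set f | _] => f /(proj1 (closure_normJP _ _)) Sf.
have /choice[p pP] : forall i : nat, exists p : K * K,
    [/\ M p.1, N p.2 & normJ (f - (p.1 + p.2)) < i.+1%:R^-1].
  move=> i; have [|g [m Mm [n Nn ->]] ?] := Sf i.+1%:R^-1; first by [].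
  by exists (m, n).
have Cauchy e : 0 < e -> exists k, forall i j, (k <= i)%N -> (k <= j)%N ->
    normJ ((p i).1 - (p j).1) < e /\ normJ ((p i).2 - (p j).2) < e.
  move=> e0; have e2 : 0 < e / (2 * C) by rewrite divr_gt0// mulr_gt0.
  have [k kP] := invS_lt _ e2; exists k => i j /kP ki /kP kj.
  have [Mi Ni fi] := pP i; have [Mj Nj fj] := pP j.
  have [] := CP _ _ (subspaceB _ _ _ sM Mi Mj) (subspaceB _ _ _ sN Ni Nj).
  have : C * normJ ((p i).1 - (p j).1 + ((p i).2 - (p j).2)) < e.
    rewrite mulrC -ltr_pdivlMr// addrACA -opprD.
    have := ler_normJD ((p i).1 + (p i).2 - f) (f - ((p j).1 + (p j).2)).
    rewrite subrKA (normJB _ f) => /le_lt_trans; apply.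
    have -> : e / C = e / (2 * C) + e / (2 * C) by field; lra.
    by apply: ltrD; [exact: lt_trans ki|exact: lt_trans kj].
  by move=> lte l1 l2; split; [exact: le_lt_trans l1 lte|exact: le_lt_trans l2 lte].
have [|m mP] := @normJ_complete _ _ (fun i => (p i).1).
  by move=> e /Cauchy[k kP]; exists k => i j ki kj; have [] := kP i j ki kj.
have [|n nP] := @normJ_complete _ _ (fun i => (p i).2).
  by move=> e /Cauchy[k kP]; exists k => i j ki kj; have [] := kP i j ki kj.
exists m; first by apply: closed_normJ_lim mP => // i; have [] := pP i.
exists n; first by apply: closed_normJ_lim nP => // i; have [] := pP i.
apply/eqP; rewrite -subr_eq0 -normJ_eq0 eq_le normJ_ge0 andbT.
apply/ler_addgt0Pr => e e0; rewrite add0r.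
have e3 : 0 < e / 3 by lra.
have [k1 k1P] := mP _ e3; have [k2 k2P] := nP _ e3; have [k3 k3P] := invS_lt _ e3.
pose k := maxn k1 (maxn k2 k3).
have [k1k k2k k3k] : [/\ (k1 <= k)%N, (k2 <= k)%N & (k3 <= k)%N].
  by rewrite !leq_max !leqnn !orbT.
have [_ _ fk] := pP k.
have := k1P k k1k; have := k2P k k2k; have := lt_trans fk (k3P k k3k).
have fE : f - (m + n) =
    f - ((p k).1 + (p k).2) + ((p k).1 - m + ((p k).2 - n)).
  by rewrite (addrACA (p k).1) -opprD addrA subrK.
rewrite {}fE; have := ler_normJD ((p k).1 - m) ((p k).2 - n).
have := ler_normJD (f - ((p k).1 + (p k).2)) ((p k).1 - m + ((p k).2 - n)).
rewrite (normJB m) (normJB n); lra.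
Qed.

Lemma maximal_direct_sum w M N : w ^+ 2 = 1 ->
  maximal_subspace (uniformly_definite w) M ->
  maximal_subspace (uniformly_definite (- w)) N -> direct_sum M N.
Proof.
move=> w1 maxM maxN.
have w1' : (- w) ^+ 2 = 1 by rewrite sqrrN.
have [sM uM _] := maxM; have [sN uN _] := maxN.
have M0 := subspace0 _ sM; have N0 := subspace0 _ sN.
split.
  apply/seteqP; split=> [f [Mf Nf]|_ ->]; last by split.
  have [a a0 /(_ f Mf) aM] := uM; have [b b0 /(_ f Nf) bN] := uN.
  (* On the intersection [w * reform f f] is both at least [a * normJ f ^+ 2] and at most
     [- b * normJ f ^+ 2]. *)
  have /eqP : normJ f ^+ 2 = 0.
    have : 0 <= normJ f ^+ 2 by exact: sqr_ge0.
    by rewrite mulNr in bN; nra.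
  by rewrite sqrf_eq0 normJ_eq0 => /eqP.
have cM := maximal_closed _ _ w1 maxM; have cN := maximal_closed _ _ w1' maxN.
have cS := definite_sum_closed _ _ _ w1 sM sN cM cN uM uN.
set S := [set f | _] in cS.
have sS : subspace S.
  apply: subspaceP => [|c _ _ [m Mm [n Nn ->]] [m' Mm' [n' Nn' ->]]].
    by exists 0 => //; exists 0; rewrite ?addr0.
  exists (c *: m + m'); first by apply: subspaceD => //; exact: subspaceZ.
  exists (c *: n + n'); first by apply: subspaceD => //; exact: subspaceZ.
  by rewrite scalerDr addrACA.
move=> f; have [p Sp fp] := projection_exists _ f sS cS.
have MS m : M m -> S m by move=> Mm; exists m => //; exists 0; rewrite ?addr0.
have NS n : N n -> S n by move=> Nn; exists 0 => //; exists n; rewrite ?add0r.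
(* Orthogonality of [f - p] to S for the inner product is J-orthogonality of [kJ K (f - p)]. The
   sign of the form at this vector decides whether maximality of M or of N makes it vanish. *)
suff Jfp : kJ K (f - p) = 0.
  suff /subr0_eq -> : f - p = 0 by [].
  by rewrite -[f - p]kJ_invol Jfp linear0.
have [q0|q0] := leP 0 (w * reform (kJ K (f - p)) (kJ K (f - p))).
  by apply: (maximal_orthogonal _ _ _ w1 maxM) => // m /MS; exact: fp.
apply: (maximal_orthogonal _ _ _ w1' maxN) => [n /NS|]; first exact: fp.
by rewrite mulNr oppr_ge0 ltW.
Qed.
End Decomposition.

(** * Ranges of the synthesis operator *)
Section SynthesisRange.
Context {R : realType} {K : kreinSpace R} {I : choiceType}.
Implicit Types (W : I -> set K) (v : I -> R) (A : set I).
Local Open Scope complex_scope.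

(** The net of partial sums is constant from F on. *)
Lemma sum_finite_support (x : I -> K) (F : {fset I}) :
  (forall i, i \notin F -> x i = 0) -> summability.sum x = \sum_(i <- F) x i.
Proof.
move=> xF; rewrite /summability.sum.
have tot := @summability.totally_filter I.
apply: cvg_lim; first exact: norm_hausdorff.
apply: cvg_near_cst; exists F => // G /= FG.
rewrite /summability.partial_sum -(big_seq_fsetE _ G xpredT).
by rewrite -(big_fset_incl _ FG)// => i _; exact: xF.
Qed.

Lemma algebraic_sum_subset W v A : (forall i, subspace (W i)) ->
  (forall i, 0 < v i) -> algebraic_sum A W `<=` synthesis_range W v A.
Proof.
move=> sW v0 _ [F [x [xP ->]]].
(* Dividing by the weights makes synthesis return the terms [x i]; finite support puts y in the
   l2-sum. *)
pose y i := if i \in F then (v i)^-1%:C *: x i else 0.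
exists y.
  split=> [i|].
    rewrite /y; case: ifPn => [/xP[_ Wx]|_]; last exact: (subspace0 _ (sW i)).
    exact: (subspaceZ _ _ _ (sW i)).
  have -> : (fun i => (normJ (y i) ^+ 2)%:E) =
      (fun i => if i \in [set` F] then (normJ (y i) ^+ 2)%:E else 0%E).
    apply/funext => i; rewrite mem_setE /y; case: ifP => // _.
    by rewrite normJ0 expr0n.
  rewrite -esum_mkcond esum_fset//; last by move=> i _; rewrite lee_fin sqr_ge0.
  by rewrite fsbig_finite//= sumEFin ltry.
rewrite /= /synthesis (@sum_finite_support _ F) => [|i iF].
  rewrite big_seq [RHS]big_seq; apply: eq_bigr => i iF.
  have [Ai _] := xP i iF.
  rewrite /ell2_proj patchT ?inE// /y iF scalerA -rmorphM mulfV ?scale1r//.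
  exact: lt0r_neq0.
by rewrite /ell2_proj /patch /y; case: ifP => _; rewrite ?(negbTE iF) scaler0//.
Qed.

(* If the net of partial sums diverges, [synthesis] returns [point], an
   unspecified vector. *)
Lemma synthesis_range_cvg W v A f : (forall i, subspace (W i)) ->
  synthesis_range W v A f -> closure (algebraic_sum A W) f \/ f = point.
Proof.
move=> sW [x [xW _] <-] /=; rewrite /synthesis /summability.sum.
set u := summability.partial_sum _.
have tot := @summability.totally_filter I.
have uA F : algebraic_sum A W (u F).
  (* The projection cancels the terms outside A, so a partial sum over F is a sum over the part of F
     in A. *)
  exists [fset i in F | i \in A]%fset, (fun i => (v i)%:C *: x i); split=> [i|].
    rewrite !inE /= => /andP[_ /set_mem Ai].
    by split=> //; exact: (subspaceZ _ _ _ (sW i)).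
  have -> : u F = \sum_(i <- F) (v i)%:C *: ell2_proj A x i.
    by rewrite big_seq_fsetE.
  rewrite -big_fset_condE /= [RHS]big_mkcond /=.
  apply: eq_bigr => i _; rewrite /ell2_proj /patch.
  by case: ifP => // _; rewrite scaler0.
have [cu|ncu] := pselect (cvg (u @ summability.totally)); last first.
  by right; rewrite dvgP.
left; apply: (closed_cvg (closure (algebraic_sum A W)) _ _ _ cu).
  exact: closed_closure.
by apply: nearW => F; exact: subset_closure.
Qed.

Lemma algebraic_sum_subspace W A :
  (forall i, subspace (W i)) -> subspace (algebraic_sum A W).
Proof.
move=> sW; apply: subspaceP => [|c _ _ [F [x [xP ->]]] [G [y [yP ->]]]].
  by exists fset0, (fun=> 0); split=> //; rewrite big_seq_fset0.
(* Families are unconstrained off their finite sets; extension by 0 lets both sums run over the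
   union. *)
pose x' i := if i \in F then c *: x i else 0.
pose y' i := if i \in G then y i else 0.
exists (F `|` G)%fset, (fun i => x' i + y' i); split=> [i|].
  rewrite inE => FGi; split.
    by case/orP: FGi => [/xP[]|/yP[]].
  apply: subspaceD => //.
    rewrite /x'; case: ifPn => [/xP[_ Wx]|_]; last exact: (subspace0 _ (sW i)).
    exact: (subspaceZ _ _ _ (sW i)).
  by rewrite /y'; case: ifPn => [/yP[]|_] //; exact: (subspace0 _ (sW i)).
rewrite big_split /=; congr (_ + _).
  rewrite -(big_fset_incl _ (fsubsetUl F G)) => [|i _ /negbTE iF]; last first.
    by rewrite /x' iF.
  rewrite scaler_sumr big_seq [RHS]big_seq.
  by apply: eq_bigr => i iF; rewrite /x' iF.
rewrite -(big_fset_incl _ (fsubsetUr F G)) => [|i _ /negbTE iG]; last first.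
  by rewrite /y' iG.
by rewrite big_seq [RHS]big_seq; apply: eq_bigr => i iG; rewrite /y' iG.
Qed.

(* The junk value [point] is harmless because the range is a subspace: if
   [point] lies in it then so does [point + point], which is [point] only if
   both are 0. *)
Lemma synthesis_range_subset W v A : (forall i, subspace (W i)) ->
  subspace (synthesis_range W v A) ->
  synthesis_range W v A `<=` closure (algebraic_sum A W).
Proof.
move=> sW sV f Vf.
have sC := closure_subspace _ (algebraic_sum_subspace W A sW).
have [//|fpt] := synthesis_range_cvg W v A f sW Vf.
have [C2|f2] := synthesis_range_cvg W v A _ sW (subspaceD _ _ _ sV Vf Vf).
  (* If [f + f] is in the closure, so is its half. *)
  have -> : f = (2^-1 : R[i]) *: (f + f).
    by rewrite scalerDr -scalerDl [X in X *: f](_ : _ = 1) ?scale1r//; field.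
  exact: (subspaceZ _ _ _ sC).
suff -> : f = 0 by exact: (subspace0 _ sC).
by apply: (addrI f); rewrite f2 addr0 -fpt.
Qed.

Lemma closure_algebraic_sum W v A w : w ^+ 2 = 1 ->
  (forall i, subspace (W i)) -> (forall i, 0 < v i) ->
  maximal_subspace (uniformly_definite w) (synthesis_range W v A) ->
  closure (algebraic_sum A W) = synthesis_range W v A.
Proof.
move=> w1 sW v0 maxA; apply/seteqP; split; last first.
  by apply: synthesis_range_subset => //; case: maxA.
rewrite [X in _ `<=` X](closure_id _).1; last exact: maximal_closed maxA.
by apply: closureS; exact: algebraic_sum_subset.
Qed.

(** The zero subspace is both J-non-negative and, vacuously, J-negative; the condition in
    [index_neg] leaves it to [index_pos] alone. *)
Lemma index_posC W v : J_family W v ->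
  index_pos W `|` index_neg W = [set: I] /\ index_pos W `&` index_neg W = set0.
Proof.
move=> famW; split; apply/seteqP; split=> // i.
  move=> _; have [sW _ _ [|negW]] := famW i; first by left.
  have [W0|] := pselect (W i = [set 0]); last by right.
  by left=> f; rewrite W0 => ->; rewrite linear0.
move=> [/= posW [W0 negW]]; apply: W0; apply/seteqP; split=> [f Wf|_ ->].
  have [//|f0] := eqVneq f 0.
  by have := le_lt_trans (posW f Wf) (negW f Wf f0); rewrite ltxx.
by have [sW _ _ _] := famW i; exact: subspace0.
Qed.
End SynthesisRange.

(** * The decomposition given by the image frame *)

Theorem theorem2p19 (R : realType) (K : kreinSpace R) (I : choiceType)
    (W : I -> set K) (v : I -> R) (T : {linear K -> K})
    (frameW : J_fusion_frame W v)
    (T_bounded : exists M : R, forall f : K, normJ (T f) <= M * normJ f)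
    (T_surj : forall g : K, exists f : K, T f = g)
    (frameTW : J_fusion_frame (fun i => T @` W i) v) :
  exists Ip Im : set I,
    let Mp := closure (algebraic_sum Ip (fun i => T @` W i)) in
    let Mm := closure (algebraic_sum Im (fun i => T @` W i)) in
    [/\ Ip `|` Im = [set: I], Ip `&` Im = set0,
        direct_sum Mp Mm &
        (maximal_subspace (@uniformly_J_positive R K) Mp /\
         maximal_subspace (@uniformly_J_negative R K) Mm) \/
        (maximal_subspace (@uniformly_J_negative R K) Mp /\
         maximal_subspace (@uniformly_J_positive R K) Mm)].
Proof.
have [famW _ maxP maxN] := frameTW.
have sW i : subspace ((fun i => T @` W i) i) by have [] := famW i.
have v0 i : 0 < v i by have [] := famW i.
have w1 : 1 ^+ 2 = 1 :> R by rewrite expr1n.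
have w2 : (- 1) ^+ 2 = 1 :> R by rewrite sqrrN.
have [Icover Idisj] := index_posC _ _ famW.
exists (index_pos (fun i => T @` W i)), (index_neg (fun i => T @` W i)).
rewrite /= uniformly_J_positiveE uniformly_J_negativeE in maxP maxN *.
rewrite (closure_algebraic_sum _ _ _ _ w1 sW v0 maxP).
rewrite (closure_algebraic_sum _ _ _ _ w2 sW v0 maxN).
by split=> //; [exact: maximal_direct_sum w1 maxP maxN|left].
Qed.
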